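(* Let $H$ be a complex Hilbert space and let $A$ and $B$ be two unbounded invertible normal operators in $H$ with domains $D(A)$ and $D(B)$ respectively, such that all sums and products formed from $A$, $B$ and their adjoints are densely defined. If $AB=BA$, $D(A)\subset D(BA^* )$ and $D(AB^{-1})=D(A(B^* )^{-1})\subset D(B)$, then $A+B$ is normal on $D(A)$; that is, $D(A+B)=D(A)$ and $A+B$ is a normal operator.
   Context: ''Unbounded operator'' means a linear operator defined on a linear subspace $D(A)$ of $H$, not necessarily bounded. For operators $A,B$: the sum $A+B$ has domain $D(A)\cap D(B)$; the product is $(BA)x=B(Ax)$ with domain $D(BA)=\{x\in D(A): Ax\in D(B)\}$. $A\subset B$ means $D(A)\subset D(B)$ and $A$, $B$ coincide on $D(A)$. Equality of operators includes equality of domains; in particular $AB=BA$ means $D(AB)=D(BA)$ and $ABx=BAx$ for all $x$ in this common domain. Standing assumption: all operators, together with any operation (sum, product) involving them or their adjoints, are densely defined; bounded operators are defined on all of $H$. An operator $A$ is invertible if there is an everywhere defined bounded operator, denoted $A^{-1}$, on $H$ with $A^{-1}A\subset AA^{-1}=I$. If $B$ is densely defined and invertible then so is $B^*$, with $(B^* )^{-1}=(B^{-1})^*$. A densely defined operator $A$ is normal if it is closed and $AA^*=A^*A$ (including equality of domains). *)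

(* Defs.v *)
From HB Require Import structures.
From mathcomp Require Export all_boot all_order all_algebra.
From mathcomp Require Export sesquilinear complex.
From mathcomp Require Export all_classical all_reals all_analysis.

Set Implicit Arguments.
Unset Strict Implicit.
Unset Printing Implicit Defensive.

Import Order.TTheory GRing.Theory Num.Theory numFieldNormedType.Exports.

Local Open Scope classical_set_scope.
Local Open Scope ring_scope.

(* A partially defined map on [H]: the values of [act] outside [dom] are
   irrelevant, and [opeq] below ignores them. *)
Record operator (H : Type) := Operator { dom : set H; act :> H -> H }.

Section Operators.
Context {R : realType} {H : completeNormedModType R[i]}.
Implicit Types A B S : operator H.

Definition linear_op A :=
  dom A 0 /\
  forall (a : R[i]) (x y : H), dom A x -> dom A y ->
    dom A (a *: x + y) /\ A (a *: x + y) = a *: A x + A y.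

Definition densely_defined A := dense (dom A).

Definition closed_op A := closed [set p : H * H | dom A p.1 /\ p.2 = A p.1].

Definition opsub A B := dom A `<=` dom B /\ forall x, dom A x -> A x = B x.

Definition opeq A B := dom A = dom B /\ forall x, dom A x -> A x = B x.

Definition opid : operator H := Operator setT id.

Definition opadd A B := Operator (dom A `&` dom B) (fun x => A x + B x).

Definition opmul B A :=
  Operator [set x | dom A x /\ dom B (A x)] (fun x => B (A x)).

Definition everywhere_bounded S :=
  [/\ linear_op S, dom S = setT &
      exists M : R[i], forall x, `|S x| <= M * `|x|].

Definition is_inverse A S :=
  [/\ everywhere_bounded S, opsub (opmul S A) (opmul A S) &
      opeq (opmul A S) opid].

Definition invertible A := exists S, is_inverse A S.

(* The inverse is unique, being everywhere defined; the value is [A] itself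
   when [A] is not invertible. *)
Definition opinv A : operator H :=
  if pselect (invertible A) is left h then projT1 (cid h) else A.

(* Inner products are linear in the first argument and conjugate-linear in the
   second. *)
Definition adjoint_at (ip : {dot H for Num.conj}) A (y z : H) :=
  forall x, dom A x -> ip (A x) y = ip x z.

(* When [A] is densely defined, [z] is uniquely determined by [y]. *)
Definition adj (ip : {dot H for Num.conj}) A :=
  Operator [set y | exists z, adjoint_at ip A y z]
           (fun y => xget 0 (adjoint_at ip A y)).

Definition normal_op (ip : {dot H for Num.conj}) A :=
  [/\ linear_op A, densely_defined A, closed_op A &
      opeq (opmul A (adj ip A)) (opmul (adj ip A) A)].

Inductive formed_from (ip : {dot H for Num.conj}) A B : operator H -> Prop :=
| formed_l : formed_from ip A B A
| formed_r : formed_from ip A B B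
| formed_adjl : formed_from ip A B (adj ip A)
| formed_adjr : formed_from ip A B (adj ip B)
| formed_add S T : formed_from ip A B S -> formed_from ip A B T ->
    formed_from ip A B (opadd S T)
| formed_mul S T : formed_from ip A B S -> formed_from ip A B T ->
    formed_from ip A B (opmul S T).

End Operators.

(* Main.v *)
(* Write [X'] for the adjoint of [X].  As [A'] maps [dom A' = dom A] onto [H],
   the inclusion [dom A `<=` dom (B A')] forces [dom B = H].  The inverse [T] of
   [A] and the inverse [S] of [B] are bounded and normal, and [A B = B A] says
   that they commute; by Fuglede's theorem [T] also commutes with [S'], so [B] and [B']
   leave [dom A] invariant and commute there with [A] and [A'].  As [B] is
   everywhere defined, [(A + B)' = A' + B'] and [A + B = (A' + B')']; the latter
   gives closedness without the closed graph theorem.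

   Fuglede's theorem is proved without operator exponentials or Liouville's
   theorem.  If [T] commutes with the normal [N], put [D F = N' F - F N'].  On
   the commutant of [N], [a D] is the commutator with the skew-adjoint operator
   [a N' - conj(a) N], so [1 + a D] increases norms by a factor [1 + O(|a|^2)]
   only.  Hence [(1 + a D)^n T = sum_k C(n, k) a^k D^k T] stays bounded for
   [|a| = O(1 / sqrt n)], and Cauchy's estimate for its linear coefficient,
   [n |a| |D T| = O(1)], yields [D T = 0]. *)
From HB Require Import structures.
Require Import Defs.
From mathcomp Require Import cyclic separable cyclotomic.
From mathcomp Require Import ring lra.
Set Implicit Arguments.
Unset Strict Implicit.
Unset Printing Implicit Defensive.
Import Order.TTheory GRing.Theory Num.Theory numFieldNormedType.Exports.
Local Open Scope classical_set_scope.
Local Open Scope ring_scope.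
Local Open Scope complex_scope.

(** * Complex norms read in the reals *)

Lemma le_epsilon (R : realType) (x y : R) :
  (forall e : R, 0 < e -> x <= y + e) -> x <= y.
Proof. by move=> xy; apply/ler_addgt0Pr. Qed.

Lemma invSn_lt (R : realType) (e : R) : 0 < e ->
  exists N, forall n, (N <= n)%N -> n.+1%:R^-1 < e.
Proof.
move=> e0; exists (Num.truncn e^-1) => n Nn; rewrite invf_plt ?posrE//.
by apply: lt_le_trans (truncnS_gt _) _; rewrite ler_nat.
Qed.

(* [complex.Re] at a carrier type that does not depend on the structure through
   which [R] is seen. *)
Definition re (R : realType) (a : R[i]) : R := complex.Re a.

Lemma re_conj (R : realType) (a : R[i]) : re (Num.conj a) = re a.
Proof. by case: a. Qed.

Lemma reD (R : realType) (a b : R[i]) : re (a + b) = re a + re b.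
Proof. by case: a b => [? ?] []. Qed.

Lemma reN (R : realType) (a : R[i]) : re (- a) = - re a.
Proof. by case: a. Qed.

Lemma reZ (R : realType) (r : R) (a : R[i]) : re (r%:C * a) = r * re a.
Proof. by case: a => x y /=; rewrite mul0r subr0. Qed.

Lemma re_i (R : realType) (a : R[i]) : re ('i%C * a) = - complex.Im a.
Proof. by case: a => x y /=; rewrite mul0r mul1r sub0r. Qed.

Section ComplexNorm.
Context {R : realType} {V : normedModType R[i]}.
Implicit Types (a b : R[i]) (x y : V).

(** Norms live in the partially ordered [R[i]]; their real parts live in [R], where infima, [lra]
    and [nra] are available. *)
Definition nrm x : R := re `|x|.
Definition cabs a : R := re `|a|.

Lemma nrmE x : `|x| = (nrm x)%:C.
Proof. by rewrite /nrm RRe_real// ger0_real. Qed.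

Lemma cabsE a : `|a| = (cabs a)%:C.
Proof. by rewrite /cabs RRe_real// ger0_real. Qed.

Lemma nrm_ge0 x : 0 <= nrm x.
Proof. by rewrite -ler0c -nrmE. Qed.

Lemma cabs_ge0 a : 0 <= cabs a.
Proof. by rewrite -ler0c -cabsE. Qed.

Lemma nrm_eq0 x : nrm x = 0 -> x = 0.
Proof. by move=> x0; apply/normr0_eq0; rewrite nrmE x0. Qed.

Lemma nrm0 : nrm (0 : V) = 0.
Proof. by rewrite /nrm normr0. Qed.

Lemma nrmD x y : nrm (x + y) <= nrm x + nrm y.
Proof. by rewrite -lecR rmorphD /= -!nrmE ler_normD. Qed.

Lemma nrmN x : nrm (- x) = nrm x.
Proof. by rewrite /nrm normrN. Qed.

Lemma nrm_distC x y : nrm (x - y) = nrm (y - x).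
Proof. by rewrite /nrm distrC. Qed.

Lemma nrm_triangle x y z : nrm (x - z) <= nrm (x - y) + nrm (y - z).
Proof. by have := nrmD (x - y) (y - z); rewrite addrA subrK. Qed.

Lemma nrmZ a x : nrm (a *: x) = cabs a * nrm x.
Proof. by apply: complexI; rewrite rmorphM /= -!nrmE -cabsE normrZ. Qed.

Lemma cabs_real (r : R) : cabs r%:C = `|r|.
Proof. by rewrite /cabs normc_def /= expr0n addr0 sqrtr_sqr. Qed.

Lemma cabsM a b : cabs (a * b) = cabs a * cabs b.
Proof. by apply: complexI; rewrite rmorphM /= -!cabsE normrM. Qed.

Lemma cabsX a n : cabs (a ^+ n) = cabs a ^+ n.
Proof. by apply: complexI; rewrite rmorphXn /= -!cabsE normrX. Qed.

Lemma cabsV a : cabs a^-1 = (cabs a)^-1.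
Proof. by apply: complexI; rewrite fmorphV /= -!cabsE normfV. Qed.

Lemma cabs_nat n : cabs (n%:R : R[i]) = n%:R.
Proof. by apply: complexI; rewrite -cabsE normr_nat rmorph_nat. Qed.

Lemma cabs_conj a : cabs (Num.conj a) = cabs a.
Proof. by rewrite /cabs norm_conjC. Qed.

Lemma nrm_sum (I : Type) (s : seq I) (F : I -> V) :
  nrm (\sum_(i <- s) F i) <= \sum_(i <- s) nrm (F i).
Proof.
elim/big_ind2 : _ => [|x a y b xa yb|//]; first by rewrite nrm0.
by apply: le_trans (nrmD _ _) _; apply: lerD.
Qed.

Lemma nrm_small x : (forall e : R, 0 < e -> nrm x <= e) -> x = 0.
Proof.
move=> xe; apply: nrm_eq0; apply/eqP; rewrite eq_le nrm_ge0 andbT.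
by apply: le_epsilon => e e0; rewrite add0r; exact: xe.
Qed.

Lemma dense_approx (D : set V) (x : V) (e : R) : dense D -> 0 < e ->
  exists2 y, D y & nrm (y - x) < e.
Proof.
move=> dD e0; have e0' : 0 < e%:C by rewrite ltcR.
have [y [+ Dy]] : (ball x e%:C) `&` D !=set0.
  by apply: dD; [exists x; exact: ballxx | exact: ball_open].
by rewrite -ball_normE /= nrmE ltcR nrm_distC => xy; exists y.
Qed.

End ComplexNorm.

Lemma nrm_cauchy (R : realType) (V : completeNormedModType R[i])
    (u : nat -> V) :
  (forall e : R, 0 < e -> exists N, forall m n, (N <= m)%N -> (N <= n)%N ->
     nrm (u m - u n) < e) ->
  exists l, forall e : R, 0 < e ->
    exists N, forall n, (N <= n)%N -> nrm (u n - l) < e.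
Proof.
move=> uC.
(* Positive elements of [R[i]] are real, so complex radii reduce to real ones. *)
have pos (e : R[i]) : 0 < e -> 0 < re e /\ e = (re e)%:C.
  move=> e0; have eE : e = (re e)%:C by rewrite RRe_real// gtr0_real.
  by split=> //; rewrite -ltcR -eE.
have /cvg_ex[l ul] : cvg (u @ \oo).
  apply/cauchy_cvgP/cauchy_exP => e /pos[e0 ->].
  have [N uN] := uC _ e0; exists (u N); exists N => //= n /= Nn.
  by rewrite -ball_normE /= nrmE ltcR; exact: uN.
exists l => e e0; have e0' : 0 < e%:C by rewrite ltcR.
move/cvgrPdist_lt : ul => /(_ _ e0')[N _ uN]; exists N => n Nn.
by have := uN n Nn; rewrite /= nrmE ltcR nrm_distC.
Qed.

(** * Inner products and bounded adjoints *)

Section InnerProduct.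
Context {R : realType} {H : completeNormedModType R[i]}.
Context (ip : {dot H for Num.conj}).
Hypothesis ip_norm : forall x : H, `|x| ^+ 2 = ip x x.
Implicit Types (a : R[i]) (x y z : H).

Lemma ipC x y : ip x y = Num.conj (ip y x).
Proof. by rewrite hermC expr0 mul1r. Qed.

Lemma ipDl x y z : ip (x + y) z = ip x z + ip y z.
Proof. exact: linearDl. Qed.

Lemma ipDr x y z : ip x (y + z) = ip x y + ip x z.
Proof. exact: linearDr. Qed.

Lemma ipNl x y : ip (- x) y = - ip x y.
Proof. exact: linearNl. Qed.

Lemma ipNr x y : ip x (- y) = - ip x y.
Proof. exact: linearNr. Qed.

Lemma ipZl a x y : ip (a *: x) y = a * ip x y.
Proof. exact: linearZl_LR. Qed.

Lemma ipZr a x y : ip x (a *: y) = Num.conj a * ip x y.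
Proof. exact: linearZr_LR. Qed.

Lemma re_ipC x y : re (ip x y) = re (ip y x).
Proof. by rewrite ipC re_conj. Qed.

Lemma nrm_sqr x : nrm x ^+ 2 = re (ip x x).
Proof. by rewrite -ip_norm nrmE -rmorphXn. Qed.

Lemma nrmD_sqr x y :
  nrm (x + y) ^+ 2 = nrm x ^+ 2 + 2 * re (ip x y) + nrm y ^+ 2.
Proof.
rewrite !nrm_sqr ipDl !ipDr !reD [re (ip y x)]re_ipC; ring.
Qed.

Lemma re_ip_le x y : re (ip x y) <= nrm x * nrm y.
Proof.
have := nrmD x y.
rewrite -ler_sqr ?nnegrE ?addr_ge0 ?nrm_ge0// nrmD_sqr sqrrD; lra.
Qed.

(** Real parts suffice: [z = x - y] already gives [nrm (x - y) ^+ 2 = 0]. *)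
Lemma ip_ext x y : (forall z, re (ip z x) = re (ip z y)) -> x = y.
Proof.
move=> xy; apply/subr0_eq/nrm_eq0/eqP; rewrite -sqrf_eq0 nrm_sqr.
by rewrite ipDr ipNr reD reN xy subrr.
Qed.

(** For [z] in [D] within [e] of [x - y], orthogonality of [z] and [x - y] gives
    [nrm (x - y) ^+ 2 <= e * nrm (x - y)]. *)
Lemma ip_ext_dense (D : set H) x y : dense D ->
  (forall z, D z -> ip z x = ip z y) -> x = y.
Proof.
move=> dD xy; apply/subr0_eq/nrm_small => e e0.
have [z Dz zxy] := dense_approx (x - y) dD e0.
have z0 : re (ip z (x - y)) = 0 by rewrite ipDr ipNr xy// subrr.
have := re_ip_le (x - y - z) (x - y).
rewrite ipDl ipNl reD reN z0 -nrm_sqr subr0 [nrm (_ - z)]nrm_distC.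
move: zxy (nrm_ge0 (x - y)); move: (nrm _) (nrm _) => a b; nra.
Qed.

(** * The Riesz representation theorem *)

Section Riesz.
Variables (f : H -> R[i]) (M : R).
Hypotheses (f_lin : forall a x y, f (a *: x + y) = a * f x + f y)
           (f_bd : forall x, re (f x) <= M * nrm x).

Let fD x y : f (x + y) = f x + f y.
Proof. by rewrite -[x]scale1r f_lin mul1r scale1r. Qed.

Let f0 : f 0 = 0.
Proof. by apply: (addrI (f 0)); rewrite -fD !addr0. Qed.

Let fZ a x : f (a *: x) = a * f x.
Proof. by rewrite -[a *: x]addr0 f_lin f0 addr0. Qed.

Let fN x : f (- x) = - f x.
Proof. by rewrite -scaleN1r fZ mulN1r. Qed.

(* The representing vector minimises [q]; the parallelogram law makes every
   minimising sequence Cauchy. *)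
Let q x := nrm x ^+ 2 - 2 * re (f x).

Let q_line x y (t : R) : q (x + t%:C *: y) =
  q x + 2 * t * (re (ip x y) - re (f y)) + t ^+ 2 * nrm y ^+ 2.
Proof.
rewrite /q nrmD_sqr fD fZ reD reZ [re (ip x _)]re_ipC ipZl reZ.
rewrite [re (ip y x)]re_ipC nrmZ cabs_real exprMn real_normK ?num_real//.
ring.
Qed.

Let q_parallelogram x y :
  nrm (x - y) ^+ 2 = 2 * q x + 2 * q y - 4 * q (x + 2^-1%:C *: (y - x)).
Proof.
rewrite q_line /q nrmD_sqr [nrm (y - x)]nrm_distC nrmD_sqr nrmN.
rewrite fD fN reD reN ipDr !ipNr !reD !reN -nrm_sqr.
by field.
Qed.

Lemma riesz : exists z, forall x, f x = ip x z.
Proof.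
pose S := range q.
have S0 : S !=set0 by exists (q 0), 0.
have Slb : has_lbound S.
  (* Complete the square: [q x >= (nrm x - M) ^+ 2 - M ^+ 2]. *)
  exists (- M ^+ 2) => _ [x _ <-]; rewrite /q.
  by have := f_bd x; have := sqr_ge0 (nrm x - M); nra.
have q_inf x : inf S <= q x by apply: ge_inf => //; exists x.
have /choice[u uP] (n : nat) : exists x, q x < inf S + n.+1%:R^-1.
  have n0 : 0 < n.+1%:R^-1 :> R by rewrite invr_gt0.
  by have [_ [x _ <-] ?] := inf_adherent n0 (conj S0 Slb); exists x.
have small (e : R) : 0 < e ->
    exists N, forall n, (N <= n)%N -> q (u n) < inf S + e.
  move=> /invSn_lt[N Ne]; exists N => n Nn; apply: lt_trans (uP n) _.
  by rewrite ltrD2l Ne.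
have [z uz] : exists l, forall e : R, 0 < e ->
    exists N, forall n, (N <= n)%N -> nrm (u n - l) < e.
  apply: nrm_cauchy => e e0.
  (* In [q_parallelogram] the two excesses over [inf S] are doubled and add up to less than
     [e ^+ 2]. *)
  have [|N uN] := small (e ^+ 2 / 4); first by rewrite divr_gt0// exprn_gt0.
  exists N => m n /uN qm /uN qn.
  rewrite -ltr_sqr ?nnegrE ?nrm_ge0 ?(ltW e0)// q_parallelogram.
  by have := q_inf (u m + 2^-1%:C *: (u n - u m)); lra.
(* First variation at the minimiser. Comparing [u n] with [u n + t x] bounds
   [re (f x) - re (ip (u n) x)] by [3 e / 4], and replacing [u n] by [z] costs less than [e / 4].
   The [+ 1] in [K] allows division when [x = 0]. *)
have fz_le x : re (f x) <= re (ip z x).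
  rewrite -subr_le0; apply: le_epsilon => e e0; rewrite add0r.
  set d := _ - _; rewrite leNgt; apply/negP => ed.
  pose K := nrm x + 1; have K0 : 0 < K by rewrite /K; move: (nrm_ge0 x); lra.
  pose t := e / K ^+ 2; have t0 : 0 < t by rewrite divr_gt0// exprn_gt0.
  have tK : t * K ^+ 2 = e by rewrite /t divfK// gt_eqF// exprn_gt0.
  have [|N1 uN1] := small (t * e / 2); first exact: divr_gt0 (mulr_gt0 t0 e0) _.
  have [|N2 uN2] := uz (e / 4 / K); first by rewrite !divr_gt0.
  pose n := maxn N1 N2.
  have := uN1 n (leq_maxl _ _); have := uN2 n (leq_maxr _ _).
  rewrite ltr_pdivlMr// => uzK qn.
  have := re_ip_le (u n - z) x; rewrite ipDl ipNl reD reN => ipuz.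
  have := q_inf (u n + t%:C *: x); rewrite q_line => qt.
  pose A := re (f x) - re (ip (u n) x).
  have At : 2 * A <= e / 2 + t * nrm x ^+ 2.
    by rewrite -(ler_pM2l t0) /A; lra.
  have xK : t * nrm x ^+ 2 <= e.
    rewrite -tK ler_pM2l// ler_sqr ?nnegrE ?nrm_ge0 ?(ltW K0)//.
    by rewrite /K lerDl.
  have uK : nrm (u n - z) * nrm x <= nrm (u n - z) * K.
    by rewrite ler_wpM2l ?nrm_ge0// /K lerDl.
  rewrite /d /A in ed At. lra.
have fz_Re x : re (f x) = re (ip x z).
  apply/eqP; rewrite eq_le [re (ip x z)]re_ipC fz_le.
  by have := fz_le (- x); rewrite fN ipNr !reN lerN2.
(* Equality of real parts at ['i *: x] is equality of imaginary parts at [x]. *)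
exists z => x; have := fz_Re ('i%C *: x); rewrite fZ ipZl !re_i => /oppr_inj.
by move: (fz_Re x); case: (f x) (ip x z) => [? ?] [? ?] /= -> ->.
Qed.
End Riesz.

Definition adjoint_pair (T Ts : H -> H) := forall x y, ip (T x) y = ip x (Ts y).

Definition bounded_by (M : R) (T : H -> H) := forall x, nrm (T x) <= M * nrm x.

Lemma adjoint_pair_sym T Ts : adjoint_pair T Ts -> adjoint_pair Ts T.
Proof. by move=> TTs x y; rewrite ipC -TTs -ipC. Qed.

Lemma adjoint_pair_linear T Ts : adjoint_pair T Ts -> linear Ts.
Proof.
move=> TTs a x y; apply: (@ip_ext_dense setT) => [? O0 _|z _].
  by rewrite setIT.
by rewrite -TTs !(ipDr, ipZr) !TTs.
Qed.

(** [Ts y] represents the functional [x |-> ip (T x) y]. The bound follows by cancelling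
    [nrm (Ts x)] in [nrm (Ts x) ^+ 2 = re (ip (T (Ts x)) x) <= M * nrm (Ts x) * nrm x]. *)
Lemma bounded_adjoint M (T : {linear H -> H}) : 0 <= M -> bounded_by M T ->
  exists2 Ts : {linear H -> H}, adjoint_pair T Ts & bounded_by M Ts.
Proof.
move=> M0 TM.
have /choice[Ts TTs] (y : H) : exists z, forall x, ip (T x) y = ip x z.
  apply: (@riesz _ (M * nrm y)) => [a x z|x].
    by rewrite linearP ipDl ipZl.
  apply: le_trans (re_ip_le _ _) _.
  by rewrite mulrAC ler_wpM2r ?nrm_ge0.
have aTTs : adjoint_pair T Ts by [].
pose linTs := GRing.isLinear.Build _ _ _ _ Ts (adjoint_pair_linear aTTs).
exists (HB.pack Ts linTs : {linear H -> H}) => // x /=.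
have [->|x0] := eqVneq (nrm (Ts x)) 0; first by rewrite mulr_ge0 ?nrm_ge0.
have Tsx : 0 < nrm (Ts x) by rewrite lt_def x0 nrm_ge0.
rewrite -(ler_pM2l Tsx) -expr2 nrm_sqr -aTTs.
apply: le_trans (re_ip_le _ _) _.
by rewrite [leRHS]mulrCA [leRHS]mulrA ler_wpM2r ?nrm_ge0.
Qed.

(* If [P] and [Q] are adjoint to each other and commute, then [Q y |-> P y] is
   isometric; so [Q y_n] converges as soon as [P y_n] does. *)
Lemma range_adjoint_sub M (P Q : {linear H -> H}) :
  0 <= M -> bounded_by M P -> bounded_by M Q -> adjoint_pair P Q ->
  (forall x, P (Q x) = Q (P x)) -> dense (range P) ->
  forall v, exists u, Q v = P u.
Proof.
move=> M0 PM QM PQ PQC dP v.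
have nPQ x : nrm (P x) = nrm (Q x).
  apply/eqP; rewrite -(@eqrXn2 _ 2) ?nrm_ge0// !nrm_sqr PQ -PQC.
  by rewrite (adjoint_pair_sym PQ).
have /choice[y yP] (n : nat) : exists y, nrm (P y - v) < n.+1%:R^-1.
  have n0 : 0 < n.+1%:R^-1 :> R by rewrite invr_gt0.
  by have [_ [y _ <-] ?] := dense_approx v dP n0; exists y.
have [u uP] : exists l, forall e : R, 0 < e ->
    exists N, forall n, (N <= n)%N -> nrm (Q (y n) - l) < e.
  apply: nrm_cauchy => e e0.
  have [N Ne] := invSn_lt (divr_gt0 e0 (ltr0n _ 2)).
  exists N => m n /Ne me /Ne ne; rewrite -linearB -nPQ linearB.
  have := nrm_triangle (P (y m)) v (P (y n)); rewrite [nrm (v - _)]nrm_distC.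
  move: (lt_trans (yP m) me) (lt_trans (yP n) ne); lra.
exists u; apply/subr0_eq/nrm_small => e e0.
(* [Q v - P u] is split at [Q (P (y n)) = P (Q (y n))]; each part is at most [M * d]. The [+ 1]
   covers [M = 0]. *)
pose d := e / (M + M + 1).
have M1 : 0 < M + M + 1 by rewrite ltr_wpDl// addr_ge0.
have d0 : 0 < d by rewrite divr_gt0.
have [N1 N1d] := invSn_lt d0; have [N2 N2d] := uP _ d0.
pose n := maxn N1 N2.
have dv := lt_trans (yP n) (N1d n (leq_maxl _ _)).
have du := N2d n (leq_maxr _ _).
apply: le_trans (nrm_triangle _ (Q (P (y n))) _) _.
rewrite -{2}PQC -!linearB; apply: le_trans (lerD (QM _) (PM _)) _.
rewrite [nrm (v - _)]nrm_distC -(divfK (lt0r_neq0 M1) e) -/d.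
have Md : M * nrm (P (y n) - v) + M * nrm (Q (y n) - u) <= M * d + M * d.
  by rewrite lerD// ler_wpM2l// ltW.
apply: le_trans Md _; rewrite mulrC; lra.
Qed.

End InnerProduct.

(** * Cauchy's estimate and Fuglede's theorem *)

(** In characteristic 0 the polynomial ['X^n - 1] is separable; its [n] distinct roots include a
    primitive one. *)
Lemma prim_root_exists (F : numClosedFieldType) n : (0 < n)%N ->
  exists w : F, n.-primitive_root w.
Proof.
move=> n0; have [rs] := closed_field_poly_normal ('X^n - 1 : {poly F}).
rewrite (monicP (monicXnsubC _ n0)) scale1r => Xn1.
have urs : uniq rs.
  by rewrite -separable_prod_XsubC -Xn1 separable_Xn_sub_1// pnatr_eq0 -lt0n.
have /hasP[w _ wn] : has n.-primitive_root rs; last by exists w.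
apply: (has_prim_root n0 _ urs).
  by apply/allP => z; rewrite -root_prod_XsubC -Xn1.
by rewrite -ltnS -(size_prod_XsubC rs id) -Xn1 size_XnsubC.
Qed.

(** Off the diagonal this is a geometric sum of ratio [v != 1] with [v ^+ n = 1]. *)
Lemma sum_prim_root (F : fieldType) n (w : F) (j k : 'I_n) :
  n.-primitive_root w ->
  \sum_(l < n) (w ^+ k / w ^+ j) ^+ l = if k == j then n%:R else 0.
Proof.
move=> wn; have n0 : (0 < n)%N by apply: leq_ltn_trans (ltn_ord j).
have w0 : w ^+ j != 0.
  apply/expf_neq0/eqP => w0; have := prim_expr_order wn.
  by rewrite w0 expr0n gtn_eqF// => /esym/eqP; rewrite oner_eq0.
case: eqP => [->|/eqP kj].
  under eq_bigr do rewrite divff// expr1n.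
  by rewrite sumr_const card_ord.
have : w ^+ k / w ^+ j != 1.
  rewrite (can2_eq (divfK w0) (mulfK w0)) mul1r (eq_prim_root_expr wn).
  by rewrite !modn_small.
rewrite -subr_eq0 => v1; apply: (mulfI v1); rewrite -subrX1 mulr0.
by rewrite expr_div_n !(exprAC _ _ n) (prim_expr_order wn) !expr1n divr1 subrr.
Qed.

(* Averaging over roots of unity isolates one coefficient. *)
Lemma cauchy_estimate (R : realType) (V : normedModType R[i]) n (c : nat -> V)
    (r M : R) : 0 <= r ->
  (forall a : R[i], cabs a = r -> nrm (\sum_(k < n.+1) a ^+ k *: c k) <= M) ->
  forall j, (j <= n)%N -> r ^+ j * nrm (c j) <= M.
Proof.
move=> r0 cM j jn; have [w wn] := prim_root_exists R[i] (ltn0Sn n).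
have w1 : cabs w = 1.
  apply/eqP; rewrite -(@eqrXn2 _ n.+1) ?cabs_ge0// expr1n -cabsX.
  by rewrite prim_expr_order// -[1](rmorph1 (@real_complex R)) /cabs normr1.
pose i := Ordinal (jn : (j < n.+1)%N).
(* The discrete Fourier coefficient of index [j] of the polynomial on the circle of radius [r]. *)
pose S := \sum_(l < n.+1) (w ^+ j) ^- l *:
            \sum_(k < n.+1) (r%:C * w ^+ l) ^+ k *: c k.
have SE : S = (n.+1%:R * r%:C ^+ j) *: c j.
  have term (k l : nat) : (w ^+ j) ^- l *: ((r%:C * w ^+ l) ^+ k *: c k) =
      (r%:C ^+ k * (w ^+ k / w ^+ j) ^+ l) *: c k.
    rewrite scalerA exprMn expr_div_n [w ^+ l ^+ k]exprAC mulrCA.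
    by rewrite [_^-1 * _]mulrC.
  rewrite /S; under eq_bigr do rewrite scaler_sumr.
  rewrite exchange_big /= (bigD1 i)//= [X in _ + X]big1 => [|k ki].
    under eq_bigr do rewrite term.
    by rewrite -scaler_suml -mulr_sumr (sum_prim_root i i wn) eqxx addr0 mulrC.
  under eq_bigr do rewrite term.
  rewrite -scaler_suml -mulr_sumr.
  by rewrite (sum_prim_root i k wn) (negPf ki) mulr0 scale0r.
have : nrm S <= n.+1%:R * M.
  apply: le_trans (nrm_sum _ _) _.
  rewrite -[n.+1 in leRHS]card_ord -sumr_const mulr_suml.
  apply: ler_sum => l _; rewrite nrmZ mul1r cabsV !cabsX w1 !expr1n invr1 mul1r.
  by apply: cM; rewrite cabsM cabsX w1 expr1n mulr1 cabs_real ger0_norm.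
by rewrite SE nrmZ cabsM cabsX cabs_nat cabs_real ger0_norm// -mulrA ler_pM2l.
Qed.

(** The binomial theorem for [1 + a D], by Pascal's rule. No norm is involved, so that it applies to
    the module of all maps [H -> H]. *)
Lemma iter_add_scale (F : comNzRingType) (V : lmodType F) (D : {linear V -> V})
    (a : F) j (x : V) :
  iter j (fun y => y + a *: D y) x =
  \sum_(k < j.+1) a ^+ k *: (iter k D x *+ 'C(j, k)).
Proof.
elim: j => [|j IH]; first by rewrite big_ord_recl big_ord0 /= scale1r addr0.
rewrite iterS IH linear_sum scaler_sumr /= [RHS]big_ord_recl /= bin0.
under [X in _ = _ + X]eq_bigr do rewrite /bump /= add1n binS mulrnDr scalerDr.
rewrite big_split /= addrA; congr (_ + _).
  rewrite [in LHS]big_ord_recl bin0; congr (_ + _).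
  by rewrite [RHS]big_ord_recr /= bin_small// mulr0n scaler0 addr0.
by apply: eq_bigr => k _; rewrite linearZ linearMn /= scalerA exprS.
Qed.

(** A converse to Bernoulli's inequality: it bounds [(1 + u) ^+ n] by 2 when [n u = 1/2]. The
    induction uses [(1 + u) (1 - (n + 1) u) <= 1 - n u]. *)
Lemma expr1D_le (R : realFieldType) (u : R) n : 0 <= u ->
  (1 + u) ^+ n * (1 - n%:R * u) <= 1.
Proof.
move=> u0; elim: n => [|n IH]; first by rewrite expr0 mul0r subr0 mulr1.
apply: le_trans IH; rewrite exprSr -mulrA ler_wpM2l ?exprn_ge0 ?addr_ge0//.
have := sqr_ge0 u; have n0 : 0 <= n%:R * u ^+ 2 by rewrite mulr_ge0 ?sqr_ge0.
by rewrite -natr1; lra.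
Qed.

Section Fuglede.
Context {R : realType} {H : completeNormedModType R[i]}.
Context (ip : {dot H for Num.conj}).
Hypothesis ip_norm : forall x : H, `|x| ^+ 2 = ip x x.

(** Pythagoras: the cross term [2 re (ip y (X y))] vanishes. *)
Lemma skew_isometry_bound (X : {linear H -> H}) c y :
  (forall x, re (ip x (X x)) = 0) -> bounded_by c X -> 0 <= c ->
  nrm (y + X y) <= Num.sqrt (1 + c ^+ 2) * nrm y.
Proof.
move=> X0 Xc c0; have s0 : 0 <= 1 + c ^+ 2 by rewrite addr_ge0// exprn_ge0.
rewrite -ler_sqr ?nnegrE ?mulr_ge0 ?sqrtr_ge0 ?nrm_ge0//.
rewrite exprMn sqr_sqrtr// (nrmD_sqr ip_norm) X0 mulr0 addr0.
rewrite mulrDl mul1r lerD2l.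
by rewrite -exprMn ler_sqr ?nnegrE ?mulr_ge0 ?nrm_ge0.
Qed.

(* [F + [X, F] = (1 + X) F (1 - X) + X F X], and [1 + X], [1 - X] are isometries
   up to second order in [X]. *)
Lemma bounded_by_skew_commutator (X F : {linear H -> H}) c m :
  (forall x, re (ip x (X x)) = 0) -> 0 <= c -> 0 <= m ->
  bounded_by c X -> bounded_by m F ->
  bounded_by (m * (1 + c ^+ 2 + c ^+ 2)) (fun x => F x + (X (F x) - F (X x))).
Proof.
move=> X0 c0 m0 Xc Fm x.
have s0 : 0 <= 1 + c ^+ 2 by rewrite addr_ge0// exprn_ge0.
pose y := F (x - X x).
have -> : F x + (X (F x) - F (X x)) = (y + X y) + X (F (X x)).
  by rewrite /y !linearB -addrA subrK -addrA [X in _ = _ + X]addrC.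
(* The factors [1 + X] and [1 - X] cost [Num.sqrt (1 + c ^+ 2)] each, the term [X F X] costs
   [m * c ^+ 2]. *)
apply: le_trans (nrmD _ _) _; rewrite mulrDr mulrDl lerD//.
  apply: le_trans (skew_isometry_bound _ X0 Xc c0) _.
  have ym : nrm y <= m * (Num.sqrt (1 + c ^+ 2) * nrm x).
    apply: le_trans (Fm _) _; rewrite ler_wpM2l//.
    have := @skew_isometry_bound (\- X) c x; apply=> // [z|z].
      by rewrite ipNr reN X0 oppr0.
    by rewrite nrmN.
  apply: le_trans (ler_wpM2l (sqrtr_ge0 _) ym) _.
  rewrite (_ : _ * (m * _) = m * Num.sqrt (1 + c ^+ 2) ^+ 2 * nrm x).
    by rewrite sqr_sqrtr.
  by ring.
apply: le_trans (Xc _) _.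
rewrite (_ : m * c ^+ 2 * nrm x = c * (m * (c * nrm x))); last by ring.
by rewrite ler_wpM2l//; apply: le_trans (Fm _) _; rewrite ler_wpM2l.
Qed.

Section Commutator.
Variables (N Ns : {linear H -> H}) (K : R).
Hypotheses (NNs : adjoint_pair ip N Ns) (K1 : 1 <= K).
Hypotheses (NK : bounded_by K N) (NsK : bounded_by K Ns).
Hypothesis N_normal : forall x, N (Ns x) = Ns (N x).

(** Taken on all maps [H -> H], a module on which it is linear, so that [iter_add_scale] applies. *)
Definition commutator (F : H -> H) : H -> H := (Ns \o F) - (F \o Ns).

Let commutator_linear : linear commutator.
Proof.
move=> a F G; apply/funext => x.
rewrite /commutator /= !fctE /= linearP scalerBr !opprD !addrA; congr (_ - _).
by rewrite addrAC.
Qed.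

HB.instance Definition _ := GRing.isLinear.Build R[i] (H -> H) (H -> H) _
  commutator commutator_linear.

Let add_commutatorE (F : H -> H) a x :
  (F + a *: commutator F) x = F x + a *: (Ns (F x) - F (Ns x)).
Proof. by []. Qed.

(* On the commutant of [N], [a *: commutator] is the commutator with the
   skew-adjoint operator [a *: Ns - Num.conj a *: N]. *)
Lemma bounded_by_commutator (F : {linear H -> H}) m a :
  0 <= m -> bounded_by m F -> (forall x, F (N x) = N (F x)) ->
  bounded_by (m * (1 + 8 * (cabs a * K) ^+ 2))
    ((F : H -> H) + a *: commutator F).
Proof.
move=> m0 Fm FN x.
pose X : {linear H -> H} := (a \*: Ns) \- (Num.conj a \*: N).
have XE y : X y = a *: Ns y - Num.conj a *: N y by [].
have -> : ((F : H -> H) + a *: commutator F) x = F x + (X (F x) - F (X x)).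
  rewrite add_commutatorE !XE (linearB F).
  rewrite [F (a *: _)]linearZZ [F (_ *: _)]linearZZ FN.
  by rewrite scalerBr opprB [X in _ = _ + X]addrA subrK.
have K0 : 0 <= K by apply: le_trans K1.
(* [X] is bounded by [c = 2 * (cabs a * K)], and [8 * (cabs a * K) ^+ 2] is twice [c ^+ 2]. *)
have -> : 1 + 8 * (cabs a * K) ^+ 2 =
    1 + (2 * (cabs a * K)) ^+ 2 + (2 * (cabs a * K)) ^+ 2 by ring.
apply: bounded_by_skew_commutator => // [y||y].
(* The two terms subtracted here are complex conjugates of each other. *)
- rewrite XE ipDr ipNr !ipZr conjCK reD reN.
  by rewrite -re_conj rmorphM /= conjCK -ipC (adjoint_pair_sym NNs) subrr.
- by rewrite !mulr_ge0// cabs_ge0.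
- rewrite XE; apply: le_trans (nrmD _ _) _; rewrite nrmN !nrmZ cabs_conj.
  rewrite -mulrDr -!mulrA mulrCA ler_wpM2l ?cabs_ge0//.
  by rewrite mulrDl !mul1r lerD.
Qed.

(** The induction also carries linearity and commutation with [N]; the latter persists because [N]
    commutes with [Ns]. *)
Lemma bounded_by_iter_commutator (T : {linear H -> H}) m a n :
  0 <= m -> bounded_by m T -> (forall x, T (N x) = N (T x)) ->
  bounded_by (m * (1 + 8 * (cabs a * K) ^+ 2) ^+ n)
    (iter n (fun F => F + a *: commutator F) (T : H -> H)).
Proof.
move=> m0 Tm TN; set u := 1 + _; set E := fun _ => _.
have u0 : 0 <= u by rewrite addr_ge0// mulr_ge0// sqr_ge0.
suff [F [FT FN Fm]] : exists F : {linear H -> H}, [/\ iter n E T = F,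
    forall x, F (N x) = N (F x) & bounded_by (m * u ^+ n) F] by rewrite FT.
elim: n => [|n [F [FT FN Fm]]]; first by exists T; rewrite expr0 mulr1.
exists (F \+ (a \*: ((Ns \o F) \- (F \o Ns))) : {linear H -> H}); split.
- by rewrite iterS FT.
- move=> x; rewrite /= -N_normal !FN [N (_ + _)]linearD [N (_ *: _)]linearZZ.
  by rewrite [N (_ - _)]linearB N_normal.
- rewrite exprSr mulrA; apply: bounded_by_commutator => //.
  by rewrite mulr_ge0// exprn_ge0.
Qed.

Theorem fuglede (T : {linear H -> H}) m :
  0 <= m -> bounded_by m T -> (forall x, T (N x) = N (T x)) ->
  forall x, T (Ns x) = Ns (T x).
Proof.
move=> m0 Tm TN x; apply/esym/subr0_eq/nrm_small => e e0.
have K0 : 0 < K by apply: lt_le_trans K1.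
have C0 : 0 <= 8 * K * m * nrm x by rewrite !mulr_ge0 ?nrm_ge0// ltW.
set C := 8 * K * m * nrm x in C0.
suff bound p : nrm (Ns (T x) - T (Ns x)) <= C / p.+1%:R.
  have C1 : 0 < C + 1 by rewrite ltr_wpDl.
  have [p /(_ p (leqnn p)) pe] := invSn_lt (divr_gt0 e0 C1).
  apply: le_trans (bound p) _; rewrite -[leRHS](divfK (lt0r_neq0 C1)) mulrC.
  by rewrite ler_pM// ?invr_ge0// ?ltW// ltrDl.
have p0 : p.+1%:R != 0 :> R by rewrite pnatr_eq0.
have K_neq0 := lt0r_neq0 K0.
(* With this radius [n * (8 * (s * K) ^+ 2) = 1/2], so the [n]-th power stays below 2, while
   [n * s = p.+1 / (4 * K)] is unbounded in [p]. *)
pose n := (p.+1 ^ 2)%N; pose s := (4 * K * p.+1%:R)^-1.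
have nE : n%:R = p.+1%:R ^+ 2 :> R by rewrite natrX.
have s0 : 0 < s by rewrite invr_gt0 !mulr_gt0.
have n_bound : (1 + 8 * (s * K) ^+ 2) ^+ n <= 2.
  have u0 : 0 <= 8 * (s * K) ^+ 2 by rewrite mulr_ge0// sqr_ge0.
  have := expr1D_le n u0.
  have -> : n%:R * (8 * (s * K) ^+ 2) = 2^-1.
    by rewrite nE /s; field; apply/andP.
  lra.
pose c k := (iter k commutator (T : H -> H) *+ 'C(n, k)) x.
(* Cauchy's estimate for the linear coefficient, which is [n] times the commutator at [x]. *)
have : s ^+ 1 * nrm (c 1%N) <= m * 2 * nrm x.
  apply: (@cauchy_estimate _ _ n); [exact: ltW| |by rewrite expn_gt0].
  move=> a /esym as_.
  have := bounded_by_iter_commutator a n m0 Tm TN x.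
  rewrite iter_add_scale fct_sumE -as_ => /le_trans; apply.
  by rewrite ler_wpM2r ?nrm_ge0// ler_wpM2l.
have -> : c 1%N = n%:R *: (Ns (T x) - T (Ns x)).
  rewrite /c bin1 scaler_nat.
  by elim: (n) => [|k IH]; rewrite ?mulr0n// !mulrS -IH.
rewrite nrmZ cabs_nat expr1 nE => sD.
rewrite ler_pdivlMr// -(ler_pM2l (_ : 0 < (4 * K)^-1)) ?invr_gt0 ?mulr_gt0//.
have -> : (4 * K)^-1 * C = m * 2 * nrm x by rewrite /C; field.
apply: le_trans sD; rewrite le_eqVlt; apply/orP; left; apply/eqP.
by rewrite /s; field; apply/andP.
Qed.

End Commutator.
End Fuglede.

(** * Inverses and adjoints of unbounded operators *)

Section Operators.
Context {R : realType} {H : completeNormedModType R[i]}.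
Context (ip : {dot H for Num.conj}).
Hypothesis ip_norm : forall x : H, `|x| ^+ 2 = ip x x.
Implicit Types (A B : operator H) (x y z : H).

(** Continuity of the inner product; the graph of [A + B] will be an intersection of such sets. *)
Lemma closed_re_ip a u : closed [set p : H * H | re (ip a p.1) = re (ip u p.2)].
Proof.
(* An inequality is enough: it is used for [a], [u] and for [- a], [- u]. *)
suff le_closure b v p :
  closure [set p : H * H | re (ip a p.1) = re (ip u p.2)] p ->
  (forall q : H * H, re (ip a q.1) = re (ip u q.2) ->
    re (ip b q.1) = re (ip v q.2)) -> re (ip b p.1) <= re (ip v p.2).
  move=> p pcl /=; apply/eqP; rewrite eq_le le_closure//=.
  rewrite -lerN2 -!reN -!ipNl le_closure// => q qau.
  by rewrite !ipNl !reN qau.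
move=> pcl sub; apply: le_epsilon => e e0.
pose K := nrm b + nrm v + 1.
have K0 : 0 < K by rewrite ltr_wpDl// addr_ge0 ?nrm_ge0.
have eK : 0 < (e / K)%:C by rewrite ltcR divr_gt0.
have [q [/sub qbv [/= ]]] := pcl _ (nbhsx_ballx p _ eK).
rewrite -!ball_normE /= !nrmE !ltcR => q1 q2.
have := re_ip_le ip_norm b (p.1 - q.1); have := re_ip_le ip_norm v (q.2 - p.2).
rewrite !ipDr !ipNr !reD !reN nrm_distC.
have b1 : nrm b * nrm (p.1 - q.1) <= nrm b * (e / K).
  by rewrite ler_wpM2l ?nrm_ge0 ?ltW.
have b2 : nrm v * nrm (p.2 - q.2) <= nrm v * (e / K).
  by rewrite ler_wpM2l ?nrm_ge0 ?ltW.
have Ke : (nrm b + nrm v + 1) * (e / K) = e.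
  by rewrite mulrC divfK// lt0r_neq0.
have : 0 < e / K by rewrite divr_gt0.
by move: (e / K) b1 b2 Ke => d; rewrite /=; lra.
Qed.

Definition inverts (T : H -> H) A :=
  (forall y, dom A (T y) /\ A (T y) = y) /\ (forall x, dom A x -> x = T (A x)).

Lemma invertsE T A x y : inverts T A -> x = T y -> dom A x /\ A x = y.
Proof. by move=> [TA _] ->. Qed.

Lemma inverts_dom T A : inverts T A -> dom A = range T.
Proof.
move=> [TA AT]; apply/seteqP; split=> [x /AT ->|_ [y _ <-]].
  by exists (A x).
exact: (TA y).1.
Qed.

(** Additivity is inherited from the inverse, which also serves for adjoints. *)
Lemma inverts_add (T : {linear H -> H}) A x y : inverts T A ->
  dom A x -> dom A y -> dom A (x + y) /\ A (x + y) = A x + A y.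
Proof.
move=> TA Ax Ay; apply: (invertsE TA).
by rewrite linearD -(TA.2 _ Ax) -(TA.2 _ Ay).
Qed.

(** This removes the perturbing term from conditions such as [dom A (A x + B x)]. *)
Lemma inverts_addE (T : {linear H -> H}) A x y : inverts T A -> dom A y ->
  dom A (x + y) <-> dom A x.
Proof.
move=> TA Ay; split=> [Axy|Ax]; last exact: (inverts_add TA Ax Ay).1.
suff /(invertsE TA)[] : x = T (A (x + y) - A y) by [].
by rewrite linearB -(TA.2 _ Axy) -(TA.2 _ Ay) addrK.
Qed.

Lemma invertible_inverts A : invertible A ->
  exists (T : {linear H -> H}) (K : R),
    [/\ 1 <= K, bounded_by K T & inverts T A].
Proof.
move=> [S [[[_ Slin] Sdom [M SM]] [SA SAE] [AS ASE]]].
have Slin' : linear (S : H -> H).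
  by move=> a x y; have [] := Slin a x y; rewrite Sdom.
pose linS := GRing.isLinear.Build _ _ _ _ (S : H -> H) Slin'.
(* [M] is an arbitrary complex number, hence [cabs M]; adding 1 secures [1 <= K]. *)
exists (HB.pack_for {linear H -> H} (S : H -> H) linS), (1 + cabs M).
split=> [|x|] /=.
- by rewrite lerDl cabs_ge0.
- have MS : 0 <= M * `|x| by apply: le_trans (SM x).
  have : nrm (S x) <= cabs M * nrm x.
    rewrite -lecR rmorphM /= -!nrmE -cabsE; apply: le_trans (SM x) _.
    by rewrite -[leLHS]ger0_norm// normrM normr_id.
  by move/le_trans; apply; rewrite ler_wpM2r ?nrm_ge0// lerDr.
- have domAS y : dom (opmul A S) y by rewrite AS.
  split=> [y|x Ax].
    by split; [exact: (domAS y).2 | exact: ASE y (domAS y)].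
  have domSA : dom (opmul S A) x by split=> //; rewrite Sdom.
  exact/esym/(etrans (SAE x domSA))/(ASE x (domAS x)).
Qed.

Lemma adjoint_at_unique A y z z' : densely_defined A ->
  adjoint_at ip A y z -> adjoint_at ip A y z' -> z = z'.
Proof.
move=> dA yz yz'; apply: (ip_ext_dense ip_norm dA) => x Ax.
by rewrite -yz// yz'.
Qed.

Lemma adjP A y : dom (adj ip A) y -> adjoint_at ip A y (adj ip A y).
Proof. by move=> ?; exact: (@xgetPex _ 0 (adjoint_at ip A y)). Qed.

Lemma adjE A y z : densely_defined A -> adjoint_at ip A y z ->
  dom (adj ip A) y /\ adj ip A y = z.
Proof.
move=> dA yz; have Ay : dom (adj ip A) y by exists z.
by split=> //; apply: adjoint_at_unique dA (adjP Ay) yz.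
Qed.

(** The inverse of the adjoint is the adjoint of the inverse: [ip (A x) (Ts z) = ip (T (A x)) z = ip
    x z] on [dom A]. *)
Lemma adj_inverts T Ts A : densely_defined A -> inverts T A ->
  adjoint_pair ip T Ts -> inverts Ts (adj ip A).
Proof.
move=> dA TA TTs; split=> [z|y /adjP Ay].
  by apply: adjE => // x Ax; rewrite -TTs -(TA.2 _ Ax).
apply: (ip_ext ip_norm) => u; congr re.
by have [TAu ATu] := TA.1 u; rewrite -TTs -{1}ATu Ay.
Qed.

(** The vector [x = T (Ts v)] solves [A' (A x) = v], hence [A (A' x) = v], which forces
    [x = Ts (T v)]. *)
Lemma normal_inverses_commute T Ts A A' : inverts T A -> inverts Ts A' ->
  opeq (opmul A A') (opmul A' A) -> forall v, T (Ts v) = Ts (T v).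
Proof.
move=> TA TsA' [AA'dom AA'] v.
have [Ax Ax_eq] := TA.1 (Ts v); have [A'y A'y_eq] := TsA'.1 v.
have : dom (opmul A' A) (T (Ts v)) by split=> //=; rewrite Ax_eq.
rewrite -AA'dom => xdom; have := AA' _ xdom; case: xdom => /= A'x AA'x.
rewrite Ax_eq A'y_eq => Ev.
by rewrite {1}(TsA'.2 _ A'x) (TA.2 _ AA'x) Ev.
Qed.

(** The two domains are the ranges of [T] and [Ts]. Both ranges are dense, so [range_adjoint_sub]
    gives each inclusion. *)
Lemma normal_invertible A : normal_op ip A -> invertible A ->
  densely_defined (adj ip A) ->
  exists (T Ts : {linear H -> H}) (K : R),
  [/\ inverts T A, inverts Ts (adj ip A), adjoint_pair ip T Ts,
      dom (adj ip A) = dom A &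
      [/\ 1 <= K, bounded_by K T, bounded_by K Ts &
          forall v, T (Ts v) = Ts (T v)]].
Proof.
move=> [_ dA _ AAadj] /invertible_inverts[T [K [K1 TK TA]]] dAadj.
have K0 : 0 <= K by apply: le_trans K1.
have [Ts TTs TsK] := bounded_adjoint ip_norm K0 TK.
have TsA := adj_inverts dA TA TTs.
have TTsC := normal_inverses_commute TA TsA AAadj.
exists T, Ts, K; split=> //.
move: dA dAadj; rewrite /densely_defined (inverts_dom TA) (inverts_dom TsA).
move=> dT dTs; apply/seteqP; split=> [_ [v _ <-]|_ [v _ <-]].
  have [u ->] := range_adjoint_sub ip_norm K0 TK TsK TTs TTsC dT v.
  by exists u.
have TsTC x : Ts (T x) = T (Ts x) by rewrite TTsC.
have TsT := adjoint_pair_sym TTs.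
have [u ->] := range_adjoint_sub ip_norm K0 TsK TK TsT TsTC dTs v.
by exists u.
Qed.

End Operators.

(** * Normality of the sum *)

Theorem theorem7 (R : realType) (H : completeNormedModType R[i])
  (ip : {dot H for Num.conj})
  (ip_norm : forall x : H, `|x| ^+ 2 = ip x x)
  (A B : operator H)
  (A_normal : normal_op ip A) (B_normal : normal_op ip B)
  (A_inv : invertible A) (B_inv : invertible B)
  (formed_dense : forall T : operator H,
    formed_from ip A B T -> densely_defined T)
  (AB_comm : opeq (opmul A B) (opmul B A))
  (domA_sub : dom A `<=` dom (opmul B (adj ip A)))
  (dom_eq : dom (opmul A (opinv B)) = dom (opmul A (opinv (adj ip B))))
  (dom_sub : dom (opmul A (opinv (adj ip B))) `<=` dom B) :
  dom (opadd A B) = dom A /\ normal_op ip (opadd A B).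
Proof.
have [T [Ts [K [TA TsA TTs domA' [K1 TK TsK _]]]]] :=
  normal_invertible ip_norm A_normal A_inv (formed_dense _ (formed_adjl _ _ _)).
have [S [Ss [L [SB SsB SSs domB' [L1 SL SsL SSsC]]]]] :=
  normal_invertible ip_norm B_normal B_inv (formed_dense _ (formed_adjr _ _ _)).
move: A_normal B_normal => [[A0 A_lin] dA _ [AA'dom AA']].
move=> [[B0 B_lin] dB _ [_ BB']].
have domB v : dom B v.
  have [A'v A'v_eq] := TsA.1 v.
  have /domA_sub[_] : dom A (Ts v) by rewrite -domA'.
  by rewrite A'v_eq.
have domB'T v : dom (adj ip B) v by rewrite domB'.
(* [x = S (T v)] solves [A (B x) = v], hence [B (A x) = v], so [x = T (S v)]. *)
have ST v : S (T v) = T (S v).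
  have [Bx Bx_eq] := SB.1 (T v); have [Ay Ay_eq] := TA.1 v.
  have : dom (opmul A B) (S (T v)) by split=> //=; rewrite Bx_eq.
  move=> xdom; have := AB_comm.2 _ xdom; rewrite /= Bx_eq Ay_eq => vE.
  move: xdom; rewrite AB_comm.1 => -[/= Ax BAx].
  by rewrite {1}(TA.2 _ Ax) (SB.2 _ BAx) -vE.
have TSs v : T (Ss v) = Ss (T v).
  apply: (fuglede ip_norm SSs L1 SL SsL SSsC (le_trans ler01 K1) TK) => x.
  by rewrite ST.
(* The adjoint of the identity [TSs]. *)
have STs v : S (Ts v) = Ts (S v).
  apply: (ip_ext ip_norm) => x; congr re.
  by rewrite -(adjoint_pair_sym SSs) -TTs TSs (adjoint_pair_sym SSs) TTs.
have BT u : B (T u) = T (B u).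
  by rewrite {1}(SB.2 u (domB u)) -ST (SB.1 _).2.
have B'T u : adj ip B (T u) = T (adj ip B u).
  by rewrite {1}(SsB.2 u (domB'T u)) TSs (SsB.1 _).2.
have BTs u : B (Ts u) = Ts (B u).
  by rewrite {1}(SB.2 u (domB u)) -STs (SB.1 _).2.
have domC : dom (opadd A B) = dom A by apply/seteqP; split=> [x []|x].
have dC : densely_defined (opadd A B) by rewrite /densely_defined domC.
have BadjB x y : ip (B x) y = ip x (adj ip B y) by apply: adjP.
have B'adjB x y : ip (adj ip B x) y = ip x (B y) by rewrite ipC -BadjB -ipC.
have A_B'x x : dom A x -> dom A (adj ip B x).
  by move=> Ax; rewrite (TA.2 _ Ax) B'T; exact: (TA.1 _).1.
have A_Bx x : dom A x -> dom A (B x).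
  by move=> Ax; rewrite (TA.2 _ Ax) BT; exact: (TA.1 _).1.
have adjC x : dom A x ->
    dom (adj ip (opadd A B)) x /\
    adj ip (opadd A B) x = adj ip A x + adj ip B x.
  rewrite -domA' => A'x; apply: adjE => // y [Ay _] /=.
  by rewrite ipDl ipDr BadjB (adjP A'x).
have domC' : dom (adj ip (opadd A B)) = dom A.
  apply/seteqP; split=> [x|x /adjC[]//].
  (* Subtracting the everywhere defined [adj ip B] turns an adjoint value of [A + B] into one of
     [A]. *)
  move=> /adjP Cx; rewrite -domA'; suff [] : dom (adj ip A) x /\
    adj ip A x = adj ip (opadd A B) x - adj ip B x by [].
  by apply: adjE => // y Ay; rewrite ipDr ipNr -Cx ?domC//= ipDl BadjB addrK.
split=> //; split=> //.
- split=> [|a x y [Ax Bx] [Ay By]]; first by rewrite domC.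
  have [Az Az_eq] := A_lin a x y Ax Ay; have [Bz Bz_eq] := B_lin a x y Bx By.
  by split; [split | rewrite /= Az_eq Bz_eq scalerDr addrACA].
- rewrite /closed_op (_ : [set p | _] = \bigcap_(u in dom A)
      [set p | re (ip (adj ip A u + adj ip B u) p.1) = re (ip u p.2)]).
    by apply: closed_bigI => u _; exact: closed_re_ip.
  apply/seteqP; split=> [p [[Ax _] pE] u Au|p xy].
    change (re (ip (adj ip A u + adj ip B u) p.1) = re (ip u p.2)).
    rewrite pE ipDl ipDr B'adjB; congr (re (_ + _)).
    have /adjP A'u : dom (adj ip A) u by rewrite domA'.
    by rewrite ipC -A'u// -ipC.
  (* Testing with [u = Ts w], where [adj ip A u = w] is arbitrary, gives [p.1 = T (p.2 - B p.1)]. *)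
  have [Ax Ax_eq] : dom A p.1 /\ A p.1 = p.2 - B p.1.
    apply: (invertsE TA); apply: (ip_ext ip_norm) => w.
    have [A'w A'w_eq] := TsA.1 w; rewrite domA' in A'w.
    have : re (ip (adj ip A (Ts w) + adj ip B (Ts w)) p.1) = re (ip (Ts w) p.2).
      exact: xy.
    rewrite A'w_eq ipDl B'adjB !(adjoint_pair_sym TTs) reD linearB ipDr ipNr.
    by rewrite reD reN => <-; rewrite addrK.
  by split; [rewrite domC | rewrite /= Ax_eq subrK].
(* For [x] in [dom A], both domain conditions reduce to those for [A] alone, as [B x] and
   [adj ip B x] stay in [dom A]; normality of [A] identifies these. *)
- have A'A_dom x : dom A x -> dom A (adj ip A x) <-> dom A (A x).
    move=> Ax; have : dom (adj ip A) x /\ dom A (adj ip A x) <->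
        dom A x /\ dom (adj ip A) (A x).
      change (dom (opmul A (adj ip A)) x <-> dom (opmul (adj ip A) A) x).
      by rewrite AA'dom.
    by rewrite domA'; tauto.
  have C'_dom x : dom A x ->
      dom A (adj ip (opadd A B) x) <-> dom A (adj ip A x).
    by move=> Ax; rewrite (adjC x Ax).2; apply: inverts_addE TA (A_B'x _ Ax).
  have C_dom x : dom A x -> dom A (opadd A B x) <-> dom A (A x).
    by move=> Ax; apply: inverts_addE TA (A_Bx _ Ax).
  have CC'_dom x : dom A x -> dom (opadd A B) (adj ip (opadd A B) x) <->
      dom (adj ip (opadd A B)) (opadd A B x).
    by move=> Ax; rewrite domC domC' C'_dom// C_dom// A'A_dom.
  split=> [|x [C'x ACx]].
    apply/seteqP; split=> x [].
      by rewrite {1}domC' => Ax /CC'_dom; split; [rewrite domC|auto].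
    by rewrite {1}domC => Ax /CC'_dom; split; [rewrite domC'|auto].
  rewrite domC in ACx.
  rewrite domC' in C'x; rename C'x into Ax.
  have A'x : dom A (adj ip A x) by apply/C'_dom.
  have AAx : dom A (A x) by apply/A'A_dom.
  have ACx' : dom A (A x + B x) by apply/C_dom.
  (* Each side expands into four terms. The pure terms agree by normality of [A] and [B], the mixed
     ones because [A] commutes with [adj ip B] and [adj ip A] with [B]. *)
  change (A (adj ip (opadd A B) x) + B (adj ip (opadd A B) x) =
    adj ip (opadd A B) (A x + B x)).
  rewrite (adjC x Ax).2 (adjC _ ACx').2.
  rewrite (inverts_add TA A'x (A_B'x _ Ax)).2.
  rewrite -domA' in AAx.
  have BAx : dom (adj ip A) (B x) by rewrite domA'; apply: A_Bx.
  rewrite (inverts_add TsA AAx BAx).2.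
  have -> : A (adj ip B x) = adj ip B (A x).
    by rewrite {1}(TA.2 _ Ax) B'T (TA.1 _).2.
  have -> : adj ip A (B x) = B (adj ip A x).
    rewrite -domA' in Ax.
    by rewrite {1}(TsA.2 _ Ax) BTs (TsA.1 _).2.
  have -> : B (adj ip A x + adj ip B x) = B (adj ip A x) + B (adj ip B x).
    exact: (inverts_add SB (domB _) (domB _)).2.
  have -> : adj ip B (A x + B x) = adj ip B (A x) + adj ip B (B x).
    exact: (inverts_add SsB (domB'T _) (domB'T _)).2.
  have <- : A (adj ip A x) = adj ip A (A x).
    by apply: AA'; split=> //; rewrite domA'.
  have <- : B (adj ip B x) = adj ip B (B x) by apply: BB'.
  by rewrite !addrA; congr (_ + _); rewrite addrAC.
Qed.
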